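(* Let $X$ be a connected, finite, simple $4$-valent graph equipped with an orientation at each vertex, let $k\geq1$, let $N=|V(\mathrm{GC}_{k,0}(X))|$ and let $\lambda_1(\mathrm{GC}_{k,0}(X))\leq\cdots\leq\lambda_N(\mathrm{GC}_{k,0}(X))$ be its Laplacian eigenvalues. Let $\nu_1(k)\leq\cdots\leq\nu_{k^2}(k)$ be the eigenvalues of the adjacency matrix, and $0=\lambda_1(k)\leq\cdots\leq\lambda_{k^2}(k)$ the eigenvalues of the Laplacian, of the $4$-valent $(k,0)$-cluster $\square(k)$. Then for $j=1,\dots,k^2$, $$\lambda_j(\mathrm{GC}_{k,0}(X))\leq 4-\nu_{k^2-j+1}(k),\qquad \lambda_{N-j+1}(\mathrm{GC}_{k,0}(X))\geq 4-\nu_j(k).$$ Moreover, $$\lambda_i(\mathrm{GC}_{k,0}(X))\leq\lambda_t(k)+\delta_{k^2-t+i}(k)\quad\text{for }1\leq i\leq t\leq k^2,$$ $$\lambda_{N-j+1}(\mathrm{GC}_{k,0}(X))\geq\lambda_{k^2-s+1}(k)+\delta_{1+s-j}(k)\quad\text{for }1\leq j\leq s\leq k^2,$$ where $\delta_j(k)=0$ for $j=1,\dots,k^2-4k+4$, $\delta_j(k)=1$ for $j=k^2-4k+5,\dots,k^2-4$, and $\delta_j(k)=2$ for $j=k^2-3,k^2-2,k^2-1,k^2$.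
   Context: The Laplacian of a graph $Y$ acts on $f\in\mathbb{C}^{V(Y)}$ by $(\Delta_Y f)(p)=\deg_Y(p)f(p)-\sum_{q\sim p}f(q)$; eigenvalues are listed with multiplicity in nondecreasing order. An orientation at each vertex is a cyclic ordering of the four edges at each vertex. The $4$-valent $(k,0)$-cluster $\square(k)$: the square with vertices $0,k,(1+i)k,ik$ is subdivided by the square lattice $\mathbb{Z}[i]$ into $k^2$ unit squares; $\square(k)$ is the graph whose vertices are their barycenters, adjacent when the squares share an edge (i.e. the $k\times k$ grid graph; its Laplacian uses its own vertex degrees). Goldberg–Coxeter construction $\mathrm{GC}_{k,0}(X)$: for each $p\in V(X)$ take a copy $\square(p)$ of $\square(k)$ on the square $S$ with vertices $0,k,(1+i)k,ik$, whose four sides are matched with the four edges at $p$ so that the cyclic order at $p$ agrees with the counterclockwise order of the sides. For each edge $e=pq$, place $\square(p)$ on $S$ with $e$ corresponding to the side from $k$ to $(1+i)k$ and $\square(q)$ (preserving orientation) on the adjacent square with vertices $k,2k,(2+i)k,(1+i)k$ with $e$ corresponding to the side from $(1+i)k$ to $k$, and join (identify) the overlapping lattice edges; the result is the $4$-valent graph $\mathrm{GC}_{k,0}(X)$, containing each $\square(p)$ as an induced subgraph. *)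

(* Defs.v *)
From HB Require Import structures.
From mathcomp Require Import all_boot all_order all_algebra.
Set Implicit Arguments.
Unset Strict Implicit.
Unset Printing Implicit Defensive.
Import Order.TTheory GRing.Theory Num.Theory.
Local Open Scope ring_scope.

Section GraphMatrices.
Variables (R : numDomainType) (T : finType) (e : rel T).

Definition adjmx : 'M[R]_#|T| :=
  \matrix_(i, j) (e (enum_val i) (enum_val j))%:R.

Definition lapmx : 'M[R]_#|T| :=
  \matrix_(i, j) ((i == j)%:R * (#|[set y | e (enum_val i) y]|)%:R
                  - (e (enum_val i) (enum_val j))%:R).
End GraphMatrices.

Definition spectrum (R : numDomainType) (n : nat) (A : 'M[R]_n) (s : seq R) : Prop :=
  sorted <=%R s /\ char_poly A = \prod_(x <- s) ('X - x%:P).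

(* 1-based indexing: ev s j = the j-th eigenvalue lambda_j *)
Definition ev (R : numDomainType) (s : seq R) (j : nat) : R := nth 0 s j.-1.

Definition gridadj (k : nat) (c c' : 'I_k * 'I_k) : bool :=
  ((val c.1 == val c'.1) && (((val c.2).+1 == val c'.2) || ((val c'.2).+1 == val c.2)))
  || ((val c.2 == val c'.2) && (((val c.1).+1 == val c'.1) || ((val c'.1).+1 == val c.1))).

Definition cluster (k : nat) : rel ('I_k * 'I_k) := fun c c' => gridadj c c'.

(* Cell (a,b) of the square [0,k]x[0,k] is the unit square [a,a+1]x[b,b+1].
   Sides of the square, in counterclockwise order:
     side 0 : from 0 to k, side 1 : from k to (1+i)k,
     side 2 : from (1+i)k to ik, side 3 : from ik to 0.
   bcell k s t = the cell adjacent to side s at position t (0 <= t < k),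
   positions counted in the counterclockwise direction of that side. *)
Definition bcell (k : nat) (s : 'I_4) (t : nat) : nat * nat :=
  match val s with
  | 0 => (t, 0)%N
  | 1 => (k.-1, t)%N
  | 2 => (k.-1 - t, k.-1)%N
  | _ => (0, k.-1 - t)%N
  end.

Definition GCvert (V : finType) (k : nat) := (V * ('I_k * 'I_k))%type.

(* An orientation of a 4-valent graph X is encoded by nbr : V -> 'I_4 -> V,
   nbr p s being the edge (neighbour) at p in cyclic position s; side s of the
   copy of the cluster at p is matched with the edge p -- nbr p s.
   Gluing along an edge pq: the cell of p at position t along its side of pq
   shares a lattice edge with the cell of q at position k-1-t along q's side
   of pq (the two copies induce opposite directions on the common side). *)
Definition GCrel (V : finType) (nbr : V -> 'I_4 -> V) (k : nat) : rel (GCvert V k) :=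
  fun x y =>
    ((x.1 == y.1) && gridadj x.2 y.2)
    || [exists sp : 'I_4, exists sq : 'I_4, exists t : 'I_k,
          [&& nbr x.1 sp == y.1, nbr y.1 sq == x.1,
              (val x.2.1, val x.2.2) == bcell k sp t
            & (val y.2.1, val y.2.2) == bcell k sq (k.-1 - t)]].

Definition delta (k j : nat) : nat :=
  if (j%:Z <= (k%:Z - 2) ^+ 2)%R then 0%N
  else if (j%:Z <= k%:Z ^+ 2 - 4)%R then 1%N else 2%N.

(* Main.v *)
Require Import Defs.
From HB Require Import structures.
From mathcomp Require Import all_boot all_order all_algebra.
From mathcomp Require Import spectral complex zify.
Set Implicit Arguments.
Unset Strict Implicit.
Unset Printing Implicit Defensive.
Import Order.TTheory GRing.Theory Num.Theory.
Local Open Scope ring_scope.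
Local Open Scope sesquilinear_scope.

(* Let G be the Laplacian of the Goldberg-Coxeter graph, a 4-regular graph in
   which each cluster is induced. Compressing G to the coordinates of one
   cluster gives 4 - A = L + D, where A and L are the adjacency and Laplacian
   matrices of the cluster and D is the diagonal matrix recording, for each
   cell, how many sides of the square it touches; delta lists the diagonal of D
   in increasing order (for k > 1). The bounds are the interlacing and Weyl
   inequalities for this compression. Both follow by intersecting subspaces on
   which a Hermitian form is at most c |u|^2 with subspaces on which it is at
   least c' |u|^2, and counting dimensions. The spectral theorem being available
   over closed fields only, this is done over R[i]. *)

(** * Hermitian forms bounded on subspaces *)

Section QuadraticForms.
Variable C : numClosedFieldType.

Definition qform n (A : 'M[C]_n) (u : 'rV[C]_n) : C := (u *m A *m u ^t*) 0 0.

Lemma qformD n (A B : 'M[C]_n) u : qform (A + B) u = qform A u + qform B u.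
Proof. by rewrite /qform mulmxDr mulmxDl mxE. Qed.

Lemma qformM m n (A : 'M[C]_n) (E : 'M[C]_(m, n)) w :
  qform A (w *m E) = qform (E *m A *m E ^t*) w.
Proof. by rewrite /qform trmx_mul map_mxM !mulmxA. Qed.

Lemma qform_diag n (d : 'rV[C]_n) u :
  qform (diag_mx d) u = \sum_i d 0 i * `|u 0 i| ^+ 2.
Proof.
rewrite /qform mxE; apply: eq_bigr => i _.
by rewrite mul_mx_diag !mxE normCK mulrAC mulrC.
Qed.

Lemma qform1_gt0 n (u : 'rV[C]_n) : u != 0 -> 0 < qform 1%:M u.
Proof. by move=> u0; rewrite /qform mulmx1 -dotmxE dotmx_is_dotmx. Qed.

(* The opposite bound, A at least c on a subspace, is [le_on (- A) (- c)]. *)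
Definition le_on n (A : 'M[C]_n) (c : C) (r : nat) : Prop :=
  exists m (U : 'M[C]_(m, n)), (r <= \rank U)%N /\
    forall u : 'rV_n, (u <= U)%MS -> qform A u <= c * qform 1%:M u.

(** Weyl's inequality in subspace form: both bounds hold on [U :&: W], and the rank formula for sums
    and intersections bounds its dimension below. *)
Lemma le_onD n (A B : 'M[C]_n) a b r s :
  le_on A a r -> le_on B b s -> le_on (A + B) (a + b) (r + s - n).
Proof.
case=> m [U [rU leU]] [p [W [sW leW]]]; exists n, (U :&: W)%MS; split.
  have := mxrank_sum_cap U W; have := rank_leq_col (U + W)%MS.
  rewrite leq_subLR => le_n eqr; apply: leq_trans (leq_add rU sW) _.
  by rewrite -eqr leq_add2r.
move=> u; rewrite sub_capmx => /andP[uU uW].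
by rewrite qformD mulrDl lerD ?leU ?leW.
Qed.

(** The rows of [E] are orthonormal, so [w *m E] has the norm of [w] and a subspace keeps its
    dimension. With [E] a coordinate selection this yields interlacing; with [E] square it is a
    change of orthonormal basis. *)
Lemma le_on_compress m n (A : 'M[C]_n) (E : 'M[C]_(m, n)) c r :
  E \is unitarymx -> le_on (E *m A *m E ^t*) c r -> le_on A c r.
Proof.
move=> Eu [p [U [rU leU]]]; exists p, (U *m E); split.
  by rewrite mxrankMfree // /row_free mxrank_unitary.
move=> _ /submxP[w ->]; rewrite mulmxA !(qformM _ E) mulmx1 (unitarymxP Eu).
by apply: leU; apply: submxMl.
Qed.

(** The two subspaces share a nonzero vector [u], and adding the bounds for [A] and [- A] there
    gives 0 <= (a - b) |u|^2. *)
Lemma le_on_rank_le n (A : 'M[C]_n) a b r s :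
  le_on A a r -> le_on (- A) (- b) s -> (n < r + s)%N -> b <= a.
Proof.
move=> leA leN ltn; have [m [U [rU leU]]] := le_onD leA leN.
have U0 : U != 0.
  by rewrite -mxrank_eq0 -lt0n (leq_trans _ rU) // subn_gt0.
have := leU _ (nz_row_sub U).
rewrite subrr /qform mulmx0 mul0mx mxE pmulr_lge0 ?subr_ge0 //.
by apply: qform1_gt0; rewrite nz_row_eq0.
Qed.

Lemma rowsub1_unitary m n (f : 'I_m -> 'I_n) :
  injective f -> rowsub f (1%:M : 'M[C]_n) \is unitarymx.
Proof.
move=> f_inj; apply/unitarymxP; rewrite mul_rowsub_mx mul1mx.
apply/matrixP=> i j; rewrite !mxE (inj_eq f_inj) eq_sym.
by case: eqP => _; rewrite ?conjC1 ?conjC0.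
Qed.

Lemma compress_rowsub1 m n (f : 'I_m -> 'I_n) (A : 'M[C]_n) :
  rowsub f 1%:M *m A *m (rowsub f 1%:M) ^t* = mxsub f f A.
Proof.
rewrite mul_rowsub_mx mul1mx; apply/matrixP=> i j; rewrite !mxE.
rewrite (bigD1 (f j)) //= !mxE eqxx conjC1 mulr1 big1 ?addr0 // => l /negPf nl.
by rewrite !mxE eq_sym nl conjC0 mulr0.
Qed.

(** The subspace is spanned by the basis vectors indexed by [a]. *)
Lemma le_on_diag n (d : 'rV[C]_n) (a : {set 'I_n}) c :
  {in a, forall i, d 0 i <= c} -> le_on (diag_mx d) c #|a|.
Proof.
move=> dc; apply: (le_on_compress (rowsub1_unitary enum_val_inj)).
rewrite compress_rowsub1; exists #|a|, 1%:M; split; first by rewrite mxrank1.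
move=> u _.
have -> : mxsub enum_val enum_val (diag_mx d)
    = diag_mx (\row_(i < #|a|) d 0 (enum_val i)).
  by apply/matrixP=> i j; rewrite !mxE (inj_eq enum_val_inj).
rewrite -diag_const_mx !qform_diag mulr_sumr; apply: ler_sum => i _.
by rewrite !mxE mul1r ler_wpM2r ?exprn_ge0 // dc ?enum_valP.
Qed.

Lemma le_on_scalar n (c : C) : le_on (c%:M : 'M_n) c n.
Proof.
have := @le_on_diag n (const_mx c) setT c.
by rewrite cardsT card_ord diag_const_mx; apply=> i _; rewrite mxE.
Qed.

Lemma le_onW n (A : 'M[C]_n) c r s : (r <= s)%N -> le_on A c s -> le_on A c r.
Proof.
move=> rs [m [U [sU leU]]]; exists m, U; split=> //.
exact: leq_trans sU.
Qed.

Lemma char_poly_unitary_conj n (P A : 'M[C]_n) : P \is unitarymx ->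
  char_poly (P ^t* *m A *m P) = char_poly A.
Proof.
move=> Pu; have PP : P ^t* *m P = 1%:M.
  by apply: mulmx1C; apply/unitarymxP.
rewrite /char_poly.
have -> : char_poly_mx (P ^t* *m A *m P)
    = map_mx polyC (P ^t*) *m char_poly_mx A *m map_mx polyC P.
  rewrite /char_poly_mx mulmxBr mulmxBl !map_mxM mul_mx_scalar -scalemxAl.
  by rewrite -[in RHS]map_mxM PP map_mx1 scalemx1.
by rewrite !det_mulmx mulrAC -det_mulmx -map_mxM PP map_mx1 det1 mul1r.
Qed.

(** The spectral theorem gives the eigenvalues in no particular order; unique factorization of the
    characteristic polynomial matches them with [s] up to permutation. *)
Lemma spectrum_diag n (A : 'M[C]_n) s : A \is hermsymmx -> spectrum A s ->
  exists P (d : 'rV[C]_n), [/\ P \is unitarymx, P *m A *m P ^t* = diag_mx d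
    & perm_eq s [seq d 0 i | i : 'I_n]].
Proof.
move=> /hermitian_normalmx/orthomx_spectralP; set P := spectralmx A.
set d := spectral_diag A => defA [_ chA]; exists P, d.
have Pu : P \is unitarymx by apply: spectral_unitarymx.
have {}defA : A = P ^t* *m diag_mx d *m P by rewrite -(invmx_unitary Pu).
split=> //.
  by rewrite defA !mulmxA (unitarymxP Pu) mul1mx -mulmxA (unitarymxP Pu) mulmx1.
apply: prod_XsubC_eq; rewrite -chA defA char_poly_unitary_conj //.
rewrite char_poly_trig ?diag_mx_is_trig // big_map big_enum /=.
by apply: eq_bigr => i _; rewrite mxE eqxx.
Qed.

Lemma card_map_ord n (d : 'I_n -> C) (p : pred C) :
  #|[set i | p (d i)]| = count p [seq d i | i : 'I_n].
Proof. by rewrite count_map cardsE cardE size_filter enumT. Qed.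

Lemma le_on_ev n (A : 'M[C]_n) s j : A \is hermsymmx -> spectrum A s ->
  (0 < j <= n)%N -> le_on A (ev s j) j /\ le_on (- A) (- ev s j) (n - j + 1).
Proof.
move=> Ah sA /andP[j0 jn]; have [P [d [Pu dA ps]]] := spectrum_diag Ah sA.
have sz : size s = n by rewrite (perm_size ps) size_map size_enum_ord.
have le_nth i l : (i <= l < n)%N -> nth 0 s i <= nth 0 s l.
  case/andP=> il ln; have [srt _] := sA.
  by apply: le_sorted_leq_nth; rewrite ?inE ?sz // (leq_ltn_trans il).
split; apply: (le_on_compress Pu).
  (* The first [j] entries of the sorted list are at most its [j]-th; ties can only enlarge the
     eigenspace sum. For [- A] below, the same is done with the last n - j + 1 entries. *)
  rewrite dA; apply: le_onW (le_on_diag (a := [set i | d 0 i <= ev s j]) _).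
    pose p : pred C := fun x => x <= ev s j.
    rewrite (card_map_ord (fun i => d 0 i) p) -(permP ps).
    rewrite -(cat_take_drop j s) count_cat.
    have sj : size (take j s) = j by rewrite size_takel ?sz.
    suff -> : count p (take j s) = j by apply: leq_addr.
    rewrite -{2}sj; apply/eqP; rewrite -all_count; apply/(all_nthP 0).
    move=> i; rewrite sj => ij; rewrite nth_take // /p.
    by apply: le_nth; rewrite -ltnS prednK // ij.
  by move=> i; rewrite inE.
rewrite mulmxN mulNmx dA -linearN /=.
apply: le_onW (le_on_diag (a := [set i | ev s j <= d 0 i]) _).
  pose p : pred C := fun x => ev s j <= x.
  rewrite (card_map_ord (fun i => d 0 i) p) -(permP ps).
  rewrite -(cat_take_drop j.-1 s) count_cat.
  have sj : size (drop j.-1 s) = (n - j + 1)%N.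
    by rewrite size_drop sz; lia.
  suff -> : count p (drop j.-1 s) = (n - j + 1)%N by apply: leq_addl.
  rewrite -sj; apply/eqP; rewrite -all_count; apply/(all_nthP 0).
  move=> i; rewrite sj => ij; rewrite nth_drop /p; apply: le_nth.
  lia.
by move=> i; rewrite inE mxE lerN2.
Qed.
End QuadraticForms.

(** * The square grid *)

Section Cells.
Variable k : nat.
Local Open Scope nat_scope.
Implicit Types (a b : 'I_k) (c : 'I_k * 'I_k) (s : 'I_4) (t : 'I_k).

(** A sum rather than a disjunction: for k = 1 the only position is both ends and counts twice. *)
Definition end_count a : nat := (val a == 0) + (val a == k.-1).

Definition side_count c : nat := end_count c.1 + end_count c.2.

Definition path_nbrs a : {set 'I_k} :=
  [set b | ((val a).+1 == val b) || ((val b).+1 == val a)].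

Lemma card_val_eq m : #|[set b : 'I_k | m == val b]| = (m < k).
Proof.
case: ltnP => [mk | km].
  by rewrite (_ : [set b | _] = [set Ordinal mk]) ?cards1 //; apply/setP=> b;
    rewrite !inE eq_sym.
apply/eqP; rewrite cards_eq0; apply/eqP/setP=> b; rewrite !inE /=.
by apply/negbTE; have := ltn_ord b; lia.
Qed.

(** Predecessor and successor are the two candidates, and each end at which [a] lies removes one. *)
Lemma card_path_nbrs a : #|path_nbrs a| + end_count a = 2.
Proof.
have -> : path_nbrs a = [set b | (val a).+1 == val b]
                     :|: [set b | (0 < a) && (a.-1 == val b)].
  by apply/setP=> b; rewrite !inE /=; lia.
rewrite cardsU (_ : _ :&: _ = set0); last first.
  by apply/setP=> b; rewrite !inE /=; lia.
rewrite cards0 subn0 card_val_eq /end_count.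
have -> : #|[set b : 'I_k | (0 < a) && (a.-1 == val b)]| = (0 < a).
  case: (posnP a) => a0 /=; first by apply: eq_card0 => b; rewrite !inE.
  by rewrite card_val_eq; have := ltn_ord a; lia.
by have := ltn_ord a; rewrite /=; lia.
Qed.

Lemma card_cluster c : #|[set c' | cluster c c']| + side_count c = 4.
Proof.
have -> : [set c' | cluster c c'] =
    setX [set c.1] (path_nbrs c.2) :|: setX (path_nbrs c.1) [set c.2].
  apply/setP=> -[a b]; rewrite !inE /cluster /gridadj /= -!val_eqE /=.
  lia.
rewrite cardsU (_ : _ :&: _ = set0); last first.
  apply/setP=> -[a b]; rewrite !inE /= -!val_eqE /=. lia.
rewrite cards0 subn0 !cardsX !cards1 mul1n muln1 /side_count.
by rewrite [X in X + _]addnC addnACA !card_path_nbrs.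
Qed.

Definition on_side s c : bool :=
  match val s with
  | 0 => val c.2 == 0 | 1 => val c.1 == k.-1
  | 2 => val c.2 == k.-1 | _ => val c.1 == 0
  end.

(** The inverse of [bcell k s] on the cells along side [s]. *)
Definition side_pos s c : nat :=
  match val s with
  | 0 => val c.1 | 1 => val c.2
  | 2 => k.-1 - val c.1 | _ => k.-1 - val c.2
  end.

Lemma eq_bcell s c m : m < k ->
  ((val c.1, val c.2) == bcell k s m) = on_side s c && (side_pos s c == m).
Proof.
case: c => a b; have := ltn_ord a; have := ltn_ord b.
rewrite /bcell /on_side /side_pos; case: s => [[|[|[|s]]] hs] /=;
  rewrite xpair_eqE; lia.
Qed.

Lemma side_pos_lt s c : side_pos s c < k.
Proof.
case: c => a b; have := ltn_ord a; have := ltn_ord b.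
rewrite /side_pos; case: s => [[|[|[|s]]] hs] /=; lia.
Qed.

Lemma card_on_side c : #|[set s | on_side s c]| = side_count c.
Proof.
rewrite -sum1dep_card big_mkcond !big_ord_recl big_ord0 /on_side /=.
rewrite /side_count /end_count; do 4 case: (_ == _); lia.
Qed.

Lemma bcell_exists s m : m < k -> exists c, (val c.1, val c.2) = bcell k s m.
Proof.
move=> mk; have k0 : 0 < k by apply: leq_ltn_trans mk.
case: k mk k0 => // k' mk _.
exists (inord (bcell k'.+1 s m).1, inord (bcell k'.+1 s m).2).
rewrite /= !inordK; first by case: (bcell _ _ _).
all: by rewrite /bcell; case: s => [[|[|[|s]]] hs] /=; lia.
Qed.

Definition ends : {set 'I_k} := [set a | 0 < end_count a].

Lemma card_ends : 1 < k -> #|ends| = 2.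
Proof.
move=> k1; have -> : ends = [set a | 0 == val a] :|: [set a | k.-1 == val a].
  by apply/setP=> a; rewrite !inE /end_count /=; lia.
rewrite cardsU !card_val_eq (_ : _ :&: _ = set0); last first.
  by apply/setP=> a; rewrite !inE /=; lia.
by rewrite cards0; lia.
Qed.

Lemma side_count0 : 0 < k -> #|[set c | side_count c == 0]| = (k - 2) ^ 2.
Proof.
move=> k0; have -> : [set c | side_count c == 0] = setX (~: ends) (~: ends).
  apply/setP=> c; rewrite !inE /side_count /=.
  by rewrite addn_eq0 -!leqn0 -!leqNgt.
rewrite cardsX cardsCs setCK card_ord mulnn; case: (ltnP 1 k) => k1.
  by rewrite card_ends.
suff -> : ends = setT by rewrite cardsT card_ord; congr (_ ^ _); lia.
by apply/setP=> a; rewrite !inE /end_count /=; have := ltn_ord a; lia.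
Qed.

Lemma side_count_ge2 : 1 < k -> #|[set c | 2 <= side_count c]| = 4.
Proof.
move=> k1; rewrite (_ : finset _ = setX ends ends) ?cardsX ?card_ends //.
apply/setP=> c; rewrite !inE /side_count /end_count /=.
by have := ltn_ord c.1; have := ltn_ord c.2; lia.
Qed.

Lemma side_count_le2 c : 1 < k -> side_count c <= 2.
Proof. by rewrite /side_count /end_count /=; lia. Qed.

(** For k > 1 the integer thresholds survive truncated subtraction. For k = 1 they do not: the
    integer square (1 - 2)^2 is 1, so [delta 1 1] is 0. *)
Lemma deltaE j : 1 < k -> delta k j =
  if j <= (k - 2) ^ 2 then 0 else if j <= k ^ 2 - 4 then 1 else 2.
Proof.
move=> k1; rewrite /delta.
have -> : (j%:Z <= (k%:Z - 2) ^+ 2)%R = (j <= (k - 2) ^ 2).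
  by rewrite subzn // -mulnn expr2; lia.
have -> // : (j%:Z <= k%:Z ^+ 2 - 4)%R = (j <= k ^ 2 - 4).
have : 2 * 2 <= k * k by apply: leq_mul.
by rewrite -mulnn expr2; lia.
Qed.

(** The cells split into (k - 2)^2 interior ones touching no side, 4 corners touching two, and the
    rest touching one; [delta k u] is the [u]-th smallest of these numbers. *)
Lemma card_side_count_le_delta u : 1 < k -> u <= k ^ 2 ->
  u <= #|[set c | side_count c <= delta k u]|.
Proof.
move=> k1 uk; rewrite deltaE //; case: ifP => [u0 | _].
  apply: leq_trans u0 _; rewrite -side_count0 ?(ltnW k1) //.
  by apply/subset_leq_card/subsetP=> c; rewrite !inE => /eqP->.
case: ifP => [u1 | _].
  apply: leq_trans u1 _; rewrite -(side_count_ge2 k1) -mulnn.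
  rewrite -{1 2}[k]card_ord -card_prod.
  rewrite -(cardsC [set c | 2 <= side_count c]) addKn subset_leq_card //.
  by apply/subsetP=> c; rewrite !inE -leqNgt.
rewrite (_ : finset _ = setT) ?cardsT ?card_prod ?card_ord ?mulnn //.
by apply/setP=> c; rewrite !inE side_count_le2.
Qed.

(** The same count from the top. It covers k = 1 as well, where [delta] is 0 and the bound is
    trivial. *)
Lemma card_side_count_ge_delta u : 0 < k -> 0 < u <= k ^ 2 ->
  k ^ 2 - u + 1 <= #|[set c | delta k u <= side_count c]|.
Proof.
have all_ge0 : #|[set c | 0 <= side_count c]| = k ^ 2.
  by rewrite (_ : finset _ = setT) ?cardsT ?card_prod ?card_ord ?mulnn.
case: (ltnP 1 k) => [k1 _|]; last first.
  move=> kle1 k0 u_le; have k1 : k = 1 by lia.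
  suff -> : delta k u = 0 by rewrite all_ge0; lia.
  by move: u_le; rewrite k1; case: u => [|[|]].
rewrite deltaE // => u_le; case: ifP => [_ | u0]; first by rewrite all_ge0; lia.
case: ifP => [_ | u1]; last first.
  have : 2 * 2 <= k ^ 2 by rewrite -mulnn leq_mul.
  by rewrite side_count_ge2 //; lia.
have -> : [set c | 0 < side_count c] = ~: [set c | side_count c == 0].
  by apply/setP=> c; rewrite !inE lt0n.
rewrite cardsCs setCK side_count0 ?(ltnW k1) // card_prod card_ord mulnn.
lia.
Qed.
End Cells.

(** * The Goldberg-Coxeter graph *)

Section GoldbergCoxeter.
Variables (V : finType) (nbr : V -> 'I_4 -> V) (k : nat).
Local Open Scope nat_scope.
Implicit Types x y : GCvert V k.

(** The part of [GCrel] joining clusters, with the position [t] eliminated: facing positions run in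
    opposite directions, so they add up to k - 1. *)
Definition glued x y : bool :=
  [exists sp : 'I_4, exists sq : 'I_4,
    [&& nbr x.1 sp == y.1, nbr y.1 sq == x.1, on_side sp x.2, on_side sq y.2
      & side_pos sp x.2 + side_pos sq y.2 == k.-1]].

Lemma GCrelE x y :
  GCrel nbr x y = (x.1 == y.1) && cluster x.2 y.2 || glued x y.
Proof.
rewrite /GCrel /cluster; congr (_ || _); apply: eq_existsb => sp.
apply: eq_existsb => sq; apply/existsP/idP => [[t]|].
  have tk := ltn_ord t.
  rewrite !eq_bcell; [|lia..].
  by move=> /and4P[-> -> /andP[-> /eqP ->] /andP[-> /eqP ->]] /=; lia.
case/and5P=> -> -> sx sy /eqP pos; exists (Ordinal (side_pos_lt sp x.2)).
have lt_x := side_pos_lt sp x.2; have lt_y := side_pos_lt sq y.2.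
rewrite /= !eq_bcell ?sx ?sy; [lia..].
Qed.

Lemma glued_sym : symmetric glued.
Proof.
move=> x y; apply/existsP/existsP => -[sp /existsP[sq /and5P[pq qp sx sy pos]]];
  by exists sq; apply/existsP; exists sp; rewrite pq qp sx sy addnC pos.
Qed.

Lemma cluster_sym : symmetric (@cluster k).
Proof. by move=> c c'; rewrite /cluster /gridadj; lia. Qed.

Lemma GCrel_sym : symmetric (@GCrel V nbr k).
Proof. by move=> x y; rewrite !GCrelE eq_sym cluster_sym glued_sym. Qed.

Hypothesis nbr_inj : forall p, injective (nbr p).
Hypothesis nbr_neq : forall p s, nbr p s != p.
Hypothesis nbr_sym : forall p s, exists s', nbr (nbr p s) s' = p.

Lemma glued_irr x y : x.1 = y.1 -> glued x y = false.
Proof.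
move=> xy; apply/existsP=> -[sp /existsP[sq /and5P[]]].
by rewrite -xy (negPf (nbr_neq _ _)).
Qed.

Lemma GCrel_same p (c c' : 'I_k * 'I_k) :
  GCrel nbr (p, c) (p, c') = cluster c c'.
Proof. by rewrite GCrelE glued_irr ?eqxx ?orbF. Qed.

(** Across each side that the cell touches lies exactly one glued cell. Distinct sides lead to
    distinct vertices of the base graph, so glued cells can be counted by their first component. *)
Lemma card_glued x : #|[set y | glued x y]| = side_count x.2.
Proof.
rewrite -card_on_side -(card_imset _ (@nbr_inj x.1)).
have fst_inj : {in [set y | glued x y] &, injective (fun y => y.1)}.
  move=> [q c] [q' c'] /=; rewrite !inE => g g' qq'.
  move: g g'; rewrite -{q'}qq'.
  case/existsP=> sp /existsP[sq /and5P[/= /eqP pq /eqP qp _ sc /eqP pos]].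
  case/existsP=> sp' /existsP[sq' /and5P[/= /eqP pq' /eqP qp' _ sc' /eqP pos']].
  (* Injectivity of [nbr] at both endpoints fixes the two sides; the position, hence the cell,
     follows. *)
  have esp : sp' = sp by apply: (nbr_inj (p := x.1)); rewrite pq.
  have esq : sq' = sq by apply: (nbr_inj (p := q)); rewrite qp.
  rewrite esp esq in sc' pos'.
  have lt_c := side_pos_lt sq c.
  have := eq_bcell sq c lt_c; rewrite sc eqxx /= => /eqP bc.
  have := eq_bcell sq c' lt_c; rewrite sc' /=.
  have -> : side_pos sq c' == side_pos sq c by lia.
  move/eqP; rewrite -bc => [[h1 h2]]; congr (_, _).
  case: c c' h1 h2 {lt_c sc sc' pos pos' bc} => [a b] [a' b'] /=.
  by move=> /val_inj-> /val_inj->.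
rewrite -(card_in_imset fst_inj); apply: eq_card => q.
apply/idP/idP => /imsetP.
  case=> y; rewrite inE => /existsP[sp /existsP[sq]].
  move=> /and5P[/= /eqP pq _ sx _ _] ->.
  by apply/imsetP; exists sp; rewrite ?inE // pq.
(* Conversely, the glued cell across [s] sits on the returning side [s'], at the complementary
   position. *)
case=> s; rewrite inE => sx ->; have [s' qp] := nbr_sym x.1 s.
have lt_x := side_pos_lt s x.2.
have lt_m : k.-1 - side_pos s x.2 < k by lia.
have [c bc] := bcell_exists s' lt_m.
apply/imsetP; exists (nbr x.1 s, c) => //; rewrite inE; apply/existsP; exists s.
apply/existsP; exists s'; rewrite qp !eqxx sx /=.
have := eq_bcell s' c lt_m; rewrite bc eqxx => /esym/andP[-> /eqP->] /=.
by rewrite subnKC //; lia.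
Qed.

(** Gluing supplies exactly the neighbours that the cell lacks inside its cluster. *)
Lemma card_GCrel x : #|[set y | GCrel nbr x y]| = 4.
Proof.
have -> : [set y | GCrel nbr x y]
    = setX [set x.1] [set c | cluster x.2 c] :|: [set y | glued x y].
  by apply/setP=> -[q c]; rewrite !inE /= GCrelE eq_sym.
rewrite cardsU (_ : _ :&: _ = set0); last first.
  apply/setP=> -[q c]; rewrite !inE /=; apply/negP=> /andP[/andP[/eqP xq _]].
  by rewrite glued_irr.
by rewrite cards0 subn0 cardsX cards1 mul1n card_glued card_cluster.
Qed.
End GoldbergCoxeter.

(** * Eigenvalue bounds *)

Section HermitianGraphMatrices.
Variables (C : numClosedFieldType) (T : finType) (e : rel T).
Hypothesis e_sym : symmetric e.

Lemma adjmx_herm : adjmx C e \is hermsymmx.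
Proof.
apply/is_hermitianmxP; rewrite expr0 scale1r; apply/matrixP=> i j.
by rewrite !mxE e_sym conjC_nat.
Qed.

Lemma lapmx_herm : lapmx C e \is hermsymmx.
Proof.
apply/is_hermitianmxP; rewrite expr0 scale1r; apply/matrixP=> i j.
rewrite !mxE rmorphB rmorphM /= !conjC_nat e_sym eq_sym.
by case: eqP => [->|_]; rewrite // !mul0r.
Qed.

Lemma lapmx_const_form c : qform (lapmx C e) (const_mx c) = 0.
Proof.
rewrite /qform (_ : const_mx c *m lapmx C e = 0) ?mul0mx ?mxE //.
apply/rowP=> j; rewrite !mxE.
under eq_bigr => i _ do rewrite !mxE e_sym.
rewrite -mulr_sumr sumrB (bigD1 j) //= eqxx mul1r big1 ?addr0; last first.
  by move=> i /negPf->; rewrite mul0r.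
rewrite -natr_sum -sum1dep_card big_mkcond /=.
rewrite (reindex _ (onW_bij _ (@enum_val_bij T))) /=.
by rewrite subrr mulr0.
Qed.
(** The line of constant vectors, on which the form vanishes; it serves the case k = 1. *)
Lemma lapmx_le_on0 (x : T) : le_on (lapmx C e) 0 1.
Proof.
exists 1%N, (const_mx 1); split.
  rewrite lt0n mxrank_eq0; apply/eqP=> /rowP/(_ (enum_rank x))/eqP.
  by rewrite !mxE oner_eq0.
move=> _ /sub_rVP[c ->]; rewrite (_ : c *: _ = const_mx c).
  by rewrite lapmx_const_form mul0r.
by apply/rowP=> i; rewrite !mxE mulr1.
Qed.
End HermitianGraphMatrices.

(** * Transfer of spectra from R to R[i] *)

Section Spectra.
Variable R : rcfType.
Local Notation toC := (real_complex R).

Lemma spectrum_complex n (A : 'M[R]_n) s :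
  spectrum A s -> spectrum (map_mx toC A) (map toC s).
Proof.
case=> srt chA; split.
  by rewrite sorted_map; apply: sub_sorted srt => x y; rewrite /= lecR.
rewrite -map_char_poly chA rmorph_prod big_map.
by apply: eq_bigr => x _; rewrite /= map_polyXsubC.
Qed.

Lemma ev_complex s j : ev (map toC s) j = toC (ev s j).
Proof.
rewrite /ev; case: (ltnP j.-1 (size s)) => sj; first exact: nth_map.
by rewrite !nth_default ?size_map ?rmorph0.
Qed.

Lemma adjmx_complex (T : finType) (e : rel T) :
  map_mx toC (adjmx R e) = adjmx R[i] e.
Proof. by apply/matrixP=> i j; rewrite !mxE rmorph_nat. Qed.

Lemma lapmx_complex (T : finType) (e : rel T) :
  map_mx toC (lapmx R e) = lapmx R[i] e.
Proof. by apply/matrixP=> i j; rewrite !mxE rmorphB rmorphM /= !rmorph_nat. Qed.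
End Spectra.

Lemma card_enum_val (T : finType) (P : pred T) :
  #|[set i : 'I_#|T| | P (enum_val i)]| = #|[set x | P x]|.
Proof.
rewrite -(on_card_preimset (onW_bij _ (@enum_val_bij T))).
by apply: eq_card => i; rewrite !inE.
Qed.

(** * Compression of the Laplacian to the cluster at a vertex p *)

Section Bounds.
Variables (C : numClosedFieldType) (V : finType).
Variables (nbr : V -> 'I_4 -> V) (k : nat).
Hypothesis nbr_inj : forall p, injective (nbr p).
Hypothesis nbr_neq : forall p s, nbr p s != p.
Hypothesis nbr_sym : forall p s, exists s', nbr (nbr p s) s' = p.
Variable p : V.
Variables lG nu lam : seq C.

Let cell : finType := ('I_k * 'I_k)%type.
Let G := lapmx C (@GCrel V nbr k).
Let A := adjmx C (@cluster k).
Let L := lapmx C (@cluster k).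
Let D : 'M[C]_#|cell| := diag_mx (\row_i (side_count (enum_val i))%:R).
Let inc (i : 'I_#|cell|) : 'I_#|{: GCvert V k}| := enum_rank (p, enum_val i).

Hypothesis HlG : spectrum G lG.
Hypothesis Hnu : spectrum A nu.
Hypothesis Hlam : spectrum L lam.

Lemma card_cell : #|cell| = (k ^ 2)%N.
Proof. by rewrite card_prod card_ord mulnn. Qed.

Lemma cell_le_GC : (k ^ 2 <= #|{: GCvert V k}|)%N.
Proof.
by rewrite card_prod -card_cell leq_pmull //; apply/card_gt0P; exists p.
Qed.

Lemma inc_inj : injective inc.
Proof. by move=> i j /enum_rank_inj[/enum_val_inj]. Qed.

Lemma lap_add_sides : L + D = 4%:M - A.
Proof.
apply/matrixP=> i j; rewrite !mxE addrAC; congr (_ - _).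
case: eqP => [_|_]; rewrite ?mulr1n ?mulr0n ?mul0r ?addr0 //.
by rewrite mul1r -natrD card_cluster.
Qed.

(** The diagonal comes from 4-regularity, the other entries from the cluster being induced. *)
Lemma mxsub_GC : mxsub inc inc G = 4%:M - A.
Proof.
apply/matrixP=> i j; rewrite !mxE (inj_eq inc_inj) !enum_rankK.
rewrite (card_GCrel nbr_inj nbr_neq nbr_sym) (GCrel_same nbr_neq).
by rewrite mulr_natl.
Qed.

Lemma le_on_GC c r : le_on (L + D) c r -> le_on G c r.
Proof.
move=> le; apply: (le_on_compress (rowsub1_unitary C inc_inj)).
by rewrite compress_rowsub1 mxsub_GC -lap_add_sides.
Qed.

Lemma le_on_GCN c r : le_on (- (L + D)) c r -> le_on (- G) c r.
Proof.
move=> le; apply: (le_on_compress (rowsub1_unitary C inc_inj)).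
by rewrite mulmxN mulNmx compress_rowsub1 mxsub_GC -lap_add_sides.
Qed.

(** Writing N for the number of vertices, [- G] is bounded by [- ev lG j] in dimension N - j + 1,
    which together with [j] exceeds N by one. *)
Lemma ev_GC_le c j : (0 < j <= k ^ 2)%N -> le_on (L + D) c j -> ev lG j <= c.
Proof.
move=> /andP[j0 jk] /le_on_GC le.
have [|_ ge] := le_on_ev (j := j) (lapmx_herm C (@GCrel_sym V nbr k)) HlG.
  by rewrite j0 (leq_trans jk cell_le_GC).
apply: le_on_rank_le le ge _.
by have := cell_le_GC; lia.
Qed.

Lemma ev_GC_ge c j : (0 < j <= k ^ 2)%N -> le_on (- (L + D)) (- c) j ->
  c <= ev lG (#|{: GCvert V k}| - j + 1).
Proof.
move=> /andP[j0 jk] /le_on_GCN ge; have := cell_le_GC.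
set N := #|{: GCvert V k}| => kN; have jN : (0 < N - j + 1 <= N)%N by lia.
have [le _] := le_on_ev (lapmx_herm C (@GCrel_sym V nbr k)) HlG jN.
by apply: le_on_rank_le le ge _; rewrite -/N; lia.
Qed.

Lemma ev_GC_adj j : (0 < j <= k ^ 2)%N ->
  ev lG j <= 4 - ev nu (k ^ 2 - j + 1) /\
  4 - ev nu j <= ev lG (#|{: GCvert V k}| - j + 1).
Proof.
move=> jk; have Ah := adjmx_herm C (@cluster_sym k).
split.
  have [|_] := le_on_ev (j := (k ^ 2 - j + 1)%N) Ah Hnu.
    by rewrite card_cell; lia.
  (* A scalar matrix is bounded on the whole space, so adding it costs no dimension. *)
  move=> /(le_onD (le_on_scalar _ 4)); rewrite -lap_add_sides => le.
  by apply: ev_GC_le => //; apply: le_onW le; rewrite card_cell; lia.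
have [|le _] := le_on_ev (j := j) Ah Hnu; first by rewrite card_cell.
apply: ev_GC_ge => //; rewrite lap_add_sides !opprB.
have := le_onD le (le_on_scalar _ (- 4)); rewrite raddfN /=.
by apply: le_onW; rewrite addnK.
Qed.

Hypothesis k_gt0 : (0 < k)%N.

Lemma ev_GC_lap_le i t : (0 < i <= t)%N -> (t <= k ^ 2)%N ->
  ev lG i <= ev lam t + (delta k (k ^ 2 - t + i))%:R.
Proof.
move=> it tk; have Lh := lapmx_herm C (@cluster_sym k).
have [|leL _] := le_on_ev (j := t) Lh Hlam.
  by rewrite card_cell; lia.
case: (ltnP 1 k) => k1.
  (* Chosen so that the subspaces for [L] and [D], of dimensions [t] and [u], meet in dimension at
     least t + u - k^2 = i. *)
  set u := (k ^ 2 - t + i)%N; have uk : (u <= k ^ 2)%N by lia.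
  have leD : le_on D (delta k u)%:R u.
    pose a := [set i : 'I_#|cell| | (side_count (enum_val i) <= delta k u)%N].
    apply: le_onW (le_on_diag (a := a) _);
      last by move=> l; rewrite inE mxE ler_nat.
    rewrite (card_enum_val (fun c => (side_count c <= delta k u)%N)).
    exact: card_side_count_le_delta.
  apply: ev_GC_le; first lia.
  by apply: le_onW (le_onD leL leD); rewrite card_cell; lia.
(* For k = 1 the single cell touches all four sides while delta is 0, so Weyl
   does not suffice; the claim reduces to ev lG 1 <= 0 <= ev lam 1. *)
have kE : k = 1%N by lia.
have [i1 t1] : i = 1%N /\ t = 1%N by move: it tk; rewrite kE; lia.
have x : GCvert V k by exact: (p, (Ordinal k_gt0, Ordinal k_gt0)).
have lG_le0 : ev lG 1 <= 0.
  have [|_ ge] := le_on_ev (j := 1%N) (lapmx_herm C (@GCrel_sym V nbr k)) HlG.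
    by apply/card_gt0P; exists x.
  apply: le_on_rank_le (lapmx_le_on0 C (@GCrel_sym V nbr k) x) ge _.
  by have := cell_le_GC; lia.
have L0 : lapmx C (@cluster k) = 0.
  have no_edge (c c' : cell) : cluster c c' = false.
    have := ltn_ord c.1; have := ltn_ord c.2.
    have := ltn_ord c'.1; have := ltn_ord c'.2.
    by rewrite /cluster /gridadj /=; lia.
  apply/matrixP=> a b; rewrite !mxE no_edge subr0.
  rewrite (_ : finset _ = set0) ?cards0 ?mulr0 //.
  by apply/setP=> c; rewrite !inE no_edge.
rewrite i1 t1 (le_trans lG_le0) // (_ : delta k _ = 0%N); last by rewrite kE.
(* The zero matrix is at least 0 on the whole space, which forces 0 <= [ev lam 1]. *)
rewrite addr0; rewrite t1 L0 in leL; apply: (le_on_rank_le leL _ (ltnSn _)).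
by rewrite !oppr0; have := le_on_scalar #|cell| (0 : C); rewrite raddf0.
Qed.

Lemma ev_GC_lap_ge j s : (0 < j <= s)%N -> (s <= k ^ 2)%N ->
  ev lam (k ^ 2 - s + 1) + (delta k (1 + s - j))%:R
    <= ev lG (#|{: GCvert V k}| - j + 1).
Proof.
move=> js sk; have Lh := lapmx_herm C (@cluster_sym k).
have [|_ geL] := le_on_ev (j := (k ^ 2 - s + 1)%N) Lh Hlam.
  by rewrite card_cell; lia.
(* Here the dimensions are [s] for [- L] and k^2 - u + 1 = k^2 - s + j for [- D], leaving [j] in the
   intersection. *)
set u := (1 + s - j)%N; have uk : (0 < u <= k ^ 2)%N by lia.
have geD : le_on (- D) (- (delta k u)%:R) (k ^ 2 - u + 1).
  pose a := [set i : 'I_#|cell| | (delta k u <= side_count (enum_val i))%N].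
  rewrite /D -linearN.
  apply: le_onW (le_on_diag (a := a) _);
    last by move=> l; rewrite inE !mxE lerN2 ler_nat.
  rewrite (card_enum_val (fun c => (delta k u <= side_count c)%N)).
  exact: card_side_count_ge_delta.
apply: ev_GC_ge; first lia.
by rewrite !opprD; apply: le_onW (le_onD geL geD); rewrite card_cell; lia.
Qed.
End Bounds.

Theorem theorem3p3 (R : rcfType) (V : finType) (e : rel V)
  (nbr : V -> 'I_4 -> V) (k : nat)
  (e_sym : symmetric e) (e_irr : irreflexive e)
  (V_nonempty : (0 < #|V|)%N) (e_conn : forall p q, connect e p q)
  (e_deg : forall p, #|[set q | e p q]| = 4%N)
  (nbr_inj : forall p, injective (nbr p))
  (nbr_adj : forall p q, e p q = [exists s, nbr p s == q])
  (k_ge1 : (1 <= k)%N)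
  (lG nu lam : seq R)
  (HlG : spectrum (lapmx R (@GCrel V nbr k)) lG)
  (Hnu : spectrum (adjmx R (@cluster k)) nu)
  (Hlam : spectrum (lapmx R (@cluster k)) lam) :
  let N := #|{: GCvert V k}| in
  (forall j : nat, (1 <= j <= k ^ 2)%N ->
     ev lG j <= 4 - ev nu (k ^ 2 - j + 1) /\
     4 - ev nu j <= ev lG (N - j + 1)) /\
  (forall i t : nat, (1 <= i <= t)%N -> (t <= k ^ 2)%N ->
     ev lG i <= ev lam t + (delta k (k ^ 2 - t + i))%:R) /\
  (forall j s : nat, (1 <= j <= s)%N -> (s <= k ^ 2)%N ->
     ev lam (k ^ 2 - s + 1) + (delta k (1 + s - j))%:R <= ev lG (N - j + 1)).
Proof.
have nbr_e p s : e p (nbr p s) by rewrite nbr_adj; apply/existsP; exists s.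
have nbr_neq p s : nbr p s != p.
  by apply/eqP=> ps; have := nbr_e p s; rewrite ps e_irr.
have nbr_sym p s : exists s', nbr (nbr p s) s' = p.
  have := nbr_e p s; rewrite e_sym nbr_adj => /existsP[s' /eqP ps].
  by exists s'.
have [p _] := card_gt0P V_nonempty.
(* The spectra pass to R[i], whose order restricts to that of R, so the inequalities descend again
   by [lecR]. *)
have := spectrum_complex HlG; rewrite lapmx_complex => HlGC.
have := spectrum_complex Hnu; rewrite adjmx_complex => HnuC.
have := spectrum_complex Hlam; rewrite lapmx_complex => HlamC.
move=> N; split; [|split].
- move=> j jk.
  have := ev_GC_adj nbr_inj nbr_neq nbr_sym p HlGC HnuC jk.
  by rewrite !ev_complex -(rmorph_nat (real_complex R)) -!rmorphB !lecR.
- move=> i t it tk.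
  have := ev_GC_lap_le nbr_inj nbr_neq nbr_sym p HlGC HlamC k_ge1 it tk.
  by rewrite !ev_complex -(rmorph_nat (real_complex R)) -rmorphD lecR.
- move=> j s js sk.
  have := ev_GC_lap_ge nbr_inj nbr_neq nbr_sym p HlGC HlamC k_ge1 js sk.
  by rewrite !ev_complex -(rmorph_nat (real_complex R)) -rmorphD lecR.
Qed.
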